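(* Let $K = \{1,k_1,k_2,\dotsc,k_p\}$, where $p\ge 1$ and $1 < k_1 < k_2 < \cdots < k_p$ are integers, be such that $H^{\infty}_K(\mathbb{D})$ is an algebra. Let $z_1,z_2,\dotsc,z_n$ be distinct points in $\mathbb{D}$ and let $w_1, w_2, \dotsc, w_n$ be points in $\mathbb{D}$. If there exists a $\lambda \in \mathbb{D}$ such that the $n\times n$ matrix $$\left[\frac{z_i^{k_p+1}\, \overline{z_j^{k_p+1}} - \varphi_{\lambda}(w_i)\, \overline{\varphi_{\lambda}(w_j)}}{1-z_i\overline{z_j}}\right]_{i,j=1}^n$$ is positive semidefinite, then there exists a function $f \in H^{\infty}_K(\mathbb{D})$ such that $f(z_i) = w_i$ for $i=1,\dotsc,n$ and $\|f\|_{\infty} \leq 1$.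
   Context: $\mathbb{D}$ is the open unit disk in $\mathbb{C}$ and $\mathbb{Z}_+$ is the set of positive integers. $H^{\infty}(\mathbb{D})$ is the set of bounded analytic functions on $\mathbb{D}$, with $\|f\|_\infty = \sup\{|f(z)| : z\in\mathbb{D}\}$. For a nonempty set $K\subset\mathbb{Z}_+$, $H^{\infty}_K(\mathbb{D}) = \{f\in H^{\infty}(\mathbb{D}) : f^{(k)}(0)=0 \text{ for all } k\in K\}$. Saying that $H^{\infty}_K(\mathbb{D})$ is an algebra means that it is an algebra under pointwise operations, i.e. it is closed under pointwise multiplication (which does not hold for every $K$). For $\lambda\in\mathbb{D}$, $\varphi_{\lambda}(z) = \frac{z-\lambda}{1-\overline{\lambda}z}$. *)

(* Defs.v *)
From HB Require Import structures.
From mathcomp Require Import all_boot all_order all_algebra.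
From mathcomp Require Import all_classical all_reals all_analysis.
From mathcomp Require Import complex.
Set Implicit Arguments.
Unset Strict Implicit.
Unset Printing Implicit Defensive.
Import Order.TTheory GRing.Theory Num.Theory.
Import numFieldNormedType.Exports.
Local Open Scope classical_set_scope.
Local Open Scope ring_scope.
Local Open Scope sesquilinear_scope.

(* [R[i]^o] is the field [R[i]] seen as a normed module over itself (with the
   usual topology): [derivable f z 1] for [f : R[i]^o -> R[i]^o] is complex
   differentiability at z, and [f^`(k)] is the k-th complex derivative. *)

Definition disk (R : realType) : set R[i]^o := [set z | `|z| < 1].

(* Functions on the disk are represented by total functions on the plane whose
   values off the disk are irrelevant. *)
Definition Hinf (R : realType) : set (R[i]^o -> R[i]^o) :=
  [set f | (forall z, disk z -> derivable f z 1) /\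
           [bounded f z | z in @disk R]].

(* [`|f z|] is an element of R[i] with zero imaginary part. *)
Definition supnorm (R : realType) (f : R[i]^o -> R[i]^o) : R :=
  sup [set complex.Re `|f z| | z in @disk R].

Definition HinfK (R : realType) (K : set nat) : set (R[i]^o -> R[i]^o) :=
  [set f | Hinf f /\ forall k, K k -> (f^`(k))%classic 0 = 0].

Definition is_algebra (R : realType) (A : set (R[i]^o -> R[i]^o)) : Prop :=
  [/\ A (fun=> 0),
      forall f g, A f -> A g -> A (fun z => f z + g z),
      forall (a : R[i]) f, A f -> A (fun z => a * f z) &
      forall f g, A f -> A g -> A (fun z => f z * g z)].

Definition blaschke (R : realType) (lambda z : R[i]) : R[i] :=
  (z - lambda) / (1 - lambda^* * z).

Definition psdmx (R : realType) (n : nat) (A : 'M[R[i]]_n) : Prop :=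
  A \is hermsymmx /\ forall v : 'cV[R[i]]_n, 0 <= (v ^t* *m A *m v) 0 0.

(* Main.v *)
Require Import Defs.
From HB Require Import structures.
From mathcomp Require Import all_boot all_order all_algebra.
From mathcomp Require Import all_classical all_reals all_analysis.
From mathcomp Require Import complex.
From mathcomp Require Import ring.
Set Implicit Arguments.
Unset Strict Implicit.
Unset Printing Implicit Defensive.
Import Order.TTheory GRing.Theory Num.Theory.
Import numFieldNormedType.Exports.
Local Open Scope classical_set_scope.
Local Open Scope ring_scope.

(* If [g = P / Q] maps the disk to the closed disk and [z^m g(z)], with
   [m = k_p + 1], takes the values [phi_lambda (w_i)] at the [z_i], then
   [f = phi_(-lambda) (z^m g)] interpolates the [w_i], and [f - lambda] is
   divisible by [z^m], so all derivatives of orders [1, ..., k_p] vanish at 0.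
   The rational function [g] comes from Schur's algorithm, run on the
   homogeneous data [(a_i, b_i) = (z_i^m, phi_lambda (w_i))] with target
   [b_i Q(z_i) = a_i P(z_i)]: this avoids a separate treatment of [z_i = 0].
   One step takes the Schur complement of the Pick matrix at the first point,
   which is, up to a positive factor, the Pick matrix of transformed data at
   the remaining points. *)

(* The names ending in [s] stand for the complex conjugates; [F] is kept abstract
   because [field] is slow with actual conjugates. *)
Lemma schur_complement_identity (F : fieldType)
    (a0 b0 z0 a b z a0s b0s z0s as' bs' zs' : F) :
  a0 * a0s - b0 * b0s != 0 -> 1 - z0 * z0s != 0 -> 1 - z * zs' != 0 ->
  1 - z * z0s != 0 -> 1 - z0 * zs' != 0 ->
  (a0 * a0s - b0 * b0s) * ((a * as' - b * bs') / (1 - z * zs')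
    - (a * a0s - b * b0s) / (1 - z * z0s)
      * ((a0 * as' - b0 * bs') / (1 - z0 * zs'))
      / ((a0 * a0s - b0 * b0s) / (1 - z0 * z0s))) =
  ((a * a0s - b * b0s) * ((z - z0) / (1 - z0s * z))
    * ((as' * a0 - bs' * b0) * ((zs' - z0s) / (1 - z0 * zs')))
   - (a0 * b - b0 * a) * (a0s * bs' - b0s * as')) / (1 - z * zs').
Proof.
move=> nD nz0 nzz nz nz'.
rewrite [z0s * z]mulrC.
have -> : (a0 * b - b0 * a) * (a0s * bs' - b0s * as') =
  (a * a0s - b * b0s) * (as' * a0 - bs' * b0)
  - (a0 * a0s - b0 * b0s) * (a * as' - b * bs') by ring.
rewrite [as' * a0]mulrC [bs' * b0]mulrC.
move: (a * a0s - b * b0s) (a0 * as' - b0 * bs') (a * as' - b * bs') => x y t.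
move: (a0 * a0s - b0 * b0s) nD => D nD.
by field; rewrite nzz nz nz' nz0 nD.
Qed.

(** * Positive semidefinite kernels and Schur complements *)

Section Pick.
Context {C : numClosedFieldType}.
Implicit Types (z a b c : nat -> C) (K : nat -> nat -> C) (P Q : {poly C}).

Definition psd_kernel n K :=
  forall c, 0 <= \sum_(i < n) \sum_(j < n) (c i)^* * c j * K i j.

Lemma quad_formS n K c :
  \sum_(i < n.+1) \sum_(j < n.+1) (c i)^* * c j * K i j =
  (c 0%N)^* * c 0%N * K 0%N 0%N + (c 0%N)^* * (\sum_(j < n) c j.+1 * K 0%N j.+1)
  + (\sum_(i < n) (c i.+1)^* * K i.+1 0%N) * c 0%N
  + \sum_(i < n) \sum_(j < n) (c i.+1)^* * c j.+1 * K i.+1 j.+1.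
Proof.
rewrite big_ord_recl /= big_ord_recl /= -!addrA; congr (_ + _).
congr (_ + _); first by rewrite mulr_sumr; apply: eq_bigr => j _; rewrite mulrA.
rewrite mulr_suml -big_split /=.
by apply: eq_bigr => i _; rewrite big_ord_recl /=; congr (_ + _); ring.
Qed.

Lemma psd_kernel_tail n K :
  psd_kernel n.+1 K -> psd_kernel n (fun i j => K i.+1 j.+1).
Proof.
move=> hK c.
pose e (j : nat) : C := if j is l.+1 then c l else 0.
by have := hK e; rewrite (quad_formS _ _ e) /= conjC0 !(mul0r, add0r, mulr0).
Qed.

Lemma psd_kernel_diag n K i : psd_kernel n K -> (i < n)%N -> 0 <= K i i.
Proof.
move=> hK lt_in; have := hK (fun j => (j == i)%:R).
rewrite (bigD1 (Ordinal lt_in)) //= [X in _ + X]big1 ?addr0; last first.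
  move=> j; rewrite -val_eqE /= => /negPf ->.
  by rewrite big1 // => l _; rewrite conjC0 !mul0r.
rewrite (bigD1 (Ordinal lt_in)) //= [X in _ + X]big1 ?addr0; last first.
  by move=> j; rewrite -val_eqE /= => /negPf ->; rewrite mulr0 mul0r.
by rewrite eqxx conjC1 !mul1r.
Qed.

(** In a positive semidefinite 2 by 2 block, a zero diagonal entry forces zero off-diagonal entries:
    otherwise a vector supported on [0] and [i.+1] makes the form negative. *)
Lemma psd_kernel_col0 n K i : (forall i j, K j i = (K i j)^*) ->
  psd_kernel n.+1 K -> K 0%N 0%N = 0 -> (i < n)%N -> K i.+1 0%N = 0.
Proof.
move=> hermK hK K00 lt_in; apply/eqP/negPn/negP => Ki0.
have Kii : 0 <= K i.+1 i.+1 by exact: psd_kernel_diag hK _.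
(* With this [t] both cross terms equal [- (K i.+1 i.+1 + 1)], so the form takes the negative value
   [- (K i.+1 i.+1 + 2)]. *)
pose t := - (K i.+1 i.+1 + 1) / K i.+1 0%N.
pose e (j : nat) : C := if j is l.+1 then (l == i)%:R else t.
have := hK e.
have one (F : nat -> C) : \sum_(j < n) (val j == i)%:R * F j = F i.
  rewrite (bigD1 (Ordinal lt_in)) //= eqxx mul1r big1 ?addr0 // => j.
  by rewrite -val_eqE /= => /negPf ->; rewrite mul0r.
rewrite (quad_formS _ _ e) /= K00 mulr0 add0r.
rewrite (one (fun j => K 0%N j.+1)).
under eq_bigr do rewrite conjC_nat.
rewrite (one (fun j => K j.+1 0%N)).
under [X in _ + X]eq_bigr => j _.
  under eq_bigr do rewrite conjC_nat -mulrA.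
  rewrite -mulr_sumr (one (fun l => K j.+1 l.+1)); over.
rewrite /= (one (fun j => K j.+1 i.+1)).
rewrite (hermK i.+1 0%N) -rmorphM.
have -> : t * K i.+1 0%N = - (K i.+1 i.+1 + 1) by rewrite /t divfK.
have -> : K i.+1 0%N * t = - (K i.+1 i.+1 + 1) by rewrite mulrC /t divfK.
rewrite rmorphN rmorphD rmorph1 /= (CrealP (ger0_real Kii)).
have -> : - (K i.+1 i.+1 + 1) + - (K i.+1 i.+1 + 1) + K i.+1 i.+1 =
  - (K i.+1 i.+1 + 2) by ring.
by rewrite oppr_ge0 => /(lt_le_trans (ltr_wpDl Kii (ltr0Sn _ 1))); rewrite ltxx.
Qed.

(** Completing the square: the form of the Schur complement at [c] is the form of [K] at [c]
    extended by the coordinate [- S / K 0 0], which minimises it. *)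
Lemma psd_kernel_schur n K : (forall i j, K j i = (K i j)^*) ->
  psd_kernel n.+1 K -> 0 < K 0%N 0%N ->
  psd_kernel n (fun i j => K i.+1 j.+1 - K i.+1 0%N * K 0%N j.+1 / K 0%N 0%N).
Proof.
move=> hermK hK K00 c.
set S := \sum_(j < n) c j * K 0%N j.+1.
pose e (j : nat) : C := if j is l.+1 then c l else - S / K 0%N 0%N.
have := hK e.
rewrite (quad_formS _ _ e) /= -/S.
have -> : \sum_(i < n) (c i)^* * K i.+1 0%N = S^*.
  by rewrite rmorph_sum; apply: eq_bigr => i _; rewrite rmorphM /= -hermK.
have K0 : K 0%N 0%N != 0 by rewrite gt_eqF.
rewrite rmorphM rmorphN fmorphV /= (CrealP (gtr0_real K00)).
congr (_ <= _).
have -> : \sum_(i < n) \sum_(j < n)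
    (c i)^* * c j * (K i.+1 j.+1 - K i.+1 0%N * K 0%N j.+1 / K 0%N 0%N) =
  \sum_(i < n) \sum_(j < n) (c i)^* * c j * K i.+1 j.+1 - S^* * S / K 0%N 0%N.
  rewrite /S rmorph_sum mulr_suml mulr_suml -sumrB; apply: eq_bigr => i _.
  rewrite mulr_sumr mulr_suml -sumrB; apply: eq_bigr => j _.
  by rewrite rmorphM /= -hermK; ring.
by field.
Qed.

Lemma eq_psd_kernel n K K' :
  (forall i j, (i < n)%N -> (j < n)%N -> K i j = K' i j) ->
  psd_kernel n K -> psd_kernel n K'.
Proof.
move=> eqK hK c; have := hK c; congr (_ <= _).
by apply: eq_bigr => i _; apply: eq_bigr => j _; rewrite eqK.
Qed.

Lemma psd_kernelZ n K d : 0 <= d -> psd_kernel n K ->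
  psd_kernel n (fun i j => d * K i j).
Proof.
move=> d0 hK c; have := mulr_ge0 d0 (hK c); congr (_ <= _).
rewrite mulr_sumr; apply: eq_bigr => i _; rewrite mulr_sumr.
by apply: eq_bigr => j _; ring.
Qed.

(** * Pick kernels and disk automorphisms *)

Definition pick_kernel z a b i j : C :=
  (a i * (a j)^* - b i * (b j)^*) / (1 - z i * (z j)^*).

Lemma pick_kernelC z a b i j : pick_kernel z a b j i = (pick_kernel z a b i j)^*.
Proof.
rewrite /pick_kernel rmorphM fmorphV !rmorphB !rmorphM rmorph1 /= !conjCK.
by rewrite ![_^* * _]mulrC.
Qed.

Lemma norm_disk_neq (x y : C) : `|x| < 1 -> `|y| < 1 -> 1 - x * y^* != 0.
Proof.
move=> x1 y1; rewrite subr_eq0 eq_sym; apply/eqP => /(congr1 Num.norm).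
rewrite normrM norm_conjC normr1 => xy.
by have := mulr_ilt1 (normr_ge0 _) (normr_ge0 _) x1 y1; rewrite xy ltxx.
Qed.

Lemma normB_sqr (x u : C) :
  `|1 - u^* * x| ^+ 2 - `|x - u| ^+ 2 = (1 - `|x| ^+ 2) * (1 - `|u| ^+ 2).
Proof.
by rewrite !normCK !rmorphB rmorphM rmorph1 /= conjCK; ring.
Qed.

Lemma disk_sqr_gt0 (x : C) : `|x| < 1 -> 0 < 1 - `|x| ^+ 2.
Proof. by move=> x1; rewrite subr_gt0 expr_lt1. Qed.

Lemma mobius_le (x u : C) : `|x| < 1 -> `|u| < 1 ->
  `|x - u| <= `|1 - u^* * x|.
Proof.
move=> x1 u1; rewrite -(ler_sqr (normr_nneg _) (normr_nneg _)) -subr_ge0 normB_sqr.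
by apply: mulr_ge0; exact/ltW/disk_sqr_gt0.
Qed.

Lemma J_unitary_sqr (u v x y : C) :
  `|u * y + v^* * x| ^+ 2 - `|v * y + u^* * x| ^+ 2 =
  (`|u| ^+ 2 - `|v| ^+ 2) * (`|y| ^+ 2 - `|x| ^+ 2).
Proof.
by rewrite !normCK !rmorphD !rmorphM /= !conjCK; ring.
Qed.

(* A fraction [x / y] of modulus at most 1 is mapped to another one by the
   automorphism of the disk sending 0 to [v / u]. *)
Lemma mobius_frac (u v x y : C) : `|v| < `|u| -> y != 0 -> `|x| <= `|y| ->
  u * y + v^* * x != 0 /\ `|v * y + u^* * x| <= `|u * y + v^* * x|.
Proof.
move=> vu y0 xy; split.
  rewrite addr_eq0; apply/eqP => /(congr1 Num.norm).
  rewrite normrN !normrM norm_conjC => e.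
  suff : `|v| * `|x| < `|u| * `|y| by rewrite e ltxx.
  apply: (@le_lt_trans _ _ (`|v| * `|y|)); first by rewrite ler_wpM2l.
  by rewrite ltr_pM2r ?normr_gt0.
rewrite -(ler_sqr (normr_nneg _) (normr_nneg _)) -subr_ge0 J_unitary_sqr.
by rewrite mulr_ge0 // subr_ge0 (ler_sqr (normr_nneg _) (normr_nneg _)) // ltW.
Qed.

(** Induction on the number of nodes. If [K 0 0 = 0], node 0 is either void or forces a unimodular
    constant; if [K 0 0 > 0], a Schur step removes node 0. *)
Lemma pick_interpolation n z a b :
  (forall i, (i < n)%N -> `|z i| < 1) -> psd_kernel n (pick_kernel z a b) ->
  exists P Q, [/\ forall x, `|x| < 1 -> Q.[x] != 0 /\ `|P.[x]| <= `|Q.[x]| &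
    forall i, (i < n)%N -> b i * Q.[z i] = a i * P.[z i]].
Proof.
elim: n z a b => [|n IHn] z a b z1 psdK.
  exists 0, 1; split=> // x _.
  by rewrite horner0 hornerC oner_neq0 normr0 normr_ge0.
have z01 : `|z 0%N| < 1 by exact: z1.
have zS1 i : (i < n)%N -> `|z i.+1| < 1 by move=> ?; exact: z1.
set K := pick_kernel z a b in psdK.
have hermK i j : K j i = (K i j)^* by exact: pick_kernelC.
have K00E : K 0%N 0%N = (`|a 0%N| ^+ 2 - `|b 0%N| ^+ 2) / (1 - `|z 0%N| ^+ 2).
  by rewrite /K /pick_kernel -!normCK.
have dz := disk_sqr_gt0 z01.
have := psd_kernel_diag psdK (ltn0Sn n).
rewrite le_eqVlt eq_sym => /orP[/eqP K00|K00].
  have ab0 : `|a 0%N| = `|b 0%N|.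
    apply/eqP; rewrite -(@eqrXn2 _ 2) ?normr_ge0 // -subr_eq0.
    have /eqP := K00E; rewrite K00 eq_sym mulf_eq0 invr_eq0 (gt_eqF dz).
    by rewrite orbF.
  have [a0|a0] := eqVneq (a 0%N) 0.
    have b0 : b 0%N = 0 by apply/eqP; rewrite -normr_eq0 -ab0 a0 normr0.
    have [P [Q [PQ1 PQ]]] :=
      IHn (z \o S) (a \o S) (b \o S) zS1 (psd_kernel_tail psdK).
    exists P, Q; split=> // -[|i] lt_in; first by rewrite a0 b0 !mul0r.
    exact: PQ.
  (* The quotient is a constant of modulus 1; the interpolation conditions say exactly that column 0
     of the kernel vanishes. *)
  exists ((a 0%N)^*)%:P, ((b 0%N)^*)%:P; split=> [x _|i lt_in].
    rewrite !hornerC !norm_conjC ab0 conjC_eq0 lexx; split=> //.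
    by rewrite -normr_eq0 -ab0 normr_eq0.
  rewrite !hornerC; case: i lt_in => [_|i lt_in].
    by rewrite -!normCK ab0.
  have /eqP := psd_kernel_col0 hermK psdK K00 lt_in.
  rewrite mulf_eq0 invr_eq0 (negPf (norm_disk_neq _ _)) ?zS1 // orbF.
  by rewrite subr_eq0 => /eqP.
have ba0 : `|b 0%N| < `|a 0%N|.
  rewrite -(ltr_sqr (normr_nneg _) (normr_nneg _)) -subr_gt0.
  by move: K00; rewrite K00E pmulr_lgt0 // invr_gt0.
(* Up to a unimodular factor, [be / al] is the image of [b / a] under the disk automorphism sending
   [b 0 / a 0] to 0. The target then vanishes at [z 0], so the Blaschke factor [bl] is divided out
   of it. *)
pose al i := a i.+1 * (a 0%N)^* - b i.+1 * (b 0%N)^*.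
pose be i := a 0%N * b i.+1 - b 0%N * a i.+1.
pose bl i := (z i.+1 - z 0%N) / (1 - (z 0%N)^* * z i.+1).
have [|P [Q [PQ1 PQ]]] :=
  IHn (z \o S) (fun i => al i * bl i) be zS1.
  have D0 : `|a 0%N| ^+ 2 - `|b 0%N| ^+ 2 != 0.
    by rewrite subr_eq0 eqrXn2 ?normr_ge0 // gt_eqF.
  have D_ge0 : 0 <= `|a 0%N| ^+ 2 - `|b 0%N| ^+ 2.
    by rewrite subr_ge0 (ler_sqr (normr_nneg _) (normr_nneg _)) ltW.
  have /eq_psd_kernel := psd_kernelZ D_ge0 (psd_kernel_schur hermK psdK K00).
  apply => i j lt_in lt_jn.
  rewrite /K /pick_kernel /al /be /bl /= !(rmorphM, rmorphB, fmorphV) /=.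
  rewrite !conjCK !rmorph1 !normCK; apply: schur_complement_identity.
  - by move: D0; rewrite !normCK.
  - by move: (gt_eqF dz); rewrite normCK => /negbT.
  - exact: norm_disk_neq (zS1 _ lt_in) (zS1 _ lt_jn).
  - exact: norm_disk_neq (zS1 _ lt_in) z01.
  - exact: norm_disk_neq z01 (zS1 _ lt_jn).
(* [X / Y] restores the Blaschke factor of [z 0]; the witnesses below apply the inverse
   automorphism, whose value at [X = 0] is [b 0 / a 0]. *)
pose X := ('X - (z 0%N)%:P) * P; pose Y := (1 - (z 0%N)^* *: 'X) * Q.
have XE x : X.[x] = (x - z 0%N) * P.[x] by rewrite /X !hornerE.
have YE x : Y.[x] = (1 - (z 0%N)^* * x) * Q.[x] by rewrite /Y !hornerE.
exists (b 0%N *: Y + (a 0%N)^* *: X), (a 0%N *: Y + (b 0%N)^* *: X).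
split=> [x x1|i lt_in]; rewrite !hornerD !hornerZ XE YE.
  have [Q0 PQx] := PQ1 x x1.
  apply: mobius_frac => //; last by rewrite !normrM ler_pM ?mobius_le.
  by rewrite mulf_neq0 // mulrC norm_disk_neq.
case: i lt_in => [|i] lt_in; first by rewrite subrr; ring.
have nz : 1 - (z 0%N)^* * z i.+1 != 0 by rewrite mulrC norm_disk_neq ?zS1.
have e : be i * ((1 - (z 0%N)^* * z i.+1) * Q.[z i.+1]) =
    al i * ((z i.+1 - z 0%N) * P.[z i.+1]).
  by rewrite mulrCA [be i * _](PQ i lt_in) /bl /=; field.
move: (_ * Q.[_]) (_ * P.[_]) e => y x; rewrite /al /be => e.
apply/eqP; rewrite -subr_eq0.
have -> : b i.+1 * (a 0%N * y + (b 0%N)^* * x)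
    - a i.+1 * (b 0%N * y + (a 0%N)^* * x) =
    (a 0%N * b i.+1 - b 0%N * a i.+1) * y
    - (a i.+1 * (a 0%N)^* - b i.+1 * (b 0%N)^*) * x by ring.
by rewrite e subrr.
Qed.
End Pick.

(** * Complex derivatives of rational functions on the disk *)

Lemma is_derive_horner (F : numFieldType) (P : {poly F}) (x : F) :
  is_derive (x : F^o) (1 : F^o) (horner P : F^o -> F^o) P^`().[x].
Proof.
elim/poly_ind: P => [|P c IH].
  rewrite deriv0 horner0 (_ : horner 0 = cst 0); first exact: is_derive_cst.
  by apply/funext => y; rewrite horner0.
rewrite (_ : horner _ = (horner P : F^o -> F^o) * id + cst c); last first.
  by apply/funext => y; rewrite hornerMXaddC.
apply: is_derive_eq.
by rewrite derivMXaddC !hornerE /= /GRing.scale /=; ring.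
Qed.

Lemma is_derive_frac (F : numFieldType) (P Q : {poly F}) (x : F) :
  Q.[x] != 0 ->
  is_derive (x : F^o) (1 : F^o) ((fun y => P.[y] / Q.[y]) : F^o -> F^o)
    ((P^`() * Q - P * Q^`()).[x] / (Q ^+ 2).[x]).
Proof.
move=> Qx0.
have dP := is_derive_horner P x; have dQ := is_derive_horner Q x.
have dV : is_derive (x : F^o) (1 : F^o) ((fun y => (Q.[y])^-1) : F^o -> F^o)
    (- Q.[x] ^- 2 * Q^`().[x]).
  apply: DeriveDef; first exact: (@derivableV F F^o (horner Q)).
  by rewrite (@deriveV F F^o (horner Q)) // derive_val.
rewrite (_ : (fun y => _) = (horner P : F^o -> F^o) * (fun y => (Q.[y])^-1)) //.
apply: is_derive_eq.
rewrite !hornerE /= /GRing.scale /=.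
by field.
Qed.

Section Disk.
Context {C : numFieldType}.
Implicit Types (P Q U V : {poly C}) (f : C^o -> C^o).

Lemma near_disk (x : C) : `|x| < 1 -> \forall y \near (x : C^o), `|y| < 1.
Proof.
by move=> x1; apply: (@cvgr_norm_lt _ _ _ (nbhs (x : C^o)) _ id x).
Qed.

(** Since the disk is open, [f] agrees with the fraction near [x], which is enough to transfer the
    derivative. *)
Lemma is_derive_disk_frac f U V (c : C) :
  (forall x, `|x| < 1 -> V.[x] != 0) ->
  (forall x, `|x| < 1 -> f x = c + U.[x] / V.[x]) ->
  forall x : C^o, `|x| < 1 ->
    is_derive x (1 : C^o) f ((U^`() * V - U * V^`()).[x] / (V ^+ 2).[x]).
Proof.
move=> V0 fE x x1.
have dU := is_derive_frac U (V0 _ x1).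
pose g : C^o -> C^o := fun y => U.[y] / V.[y].
apply: (@near_eq_is_derive _ _ _ ((cst c : C^o -> C^o) + g)).
  by near=> y; rewrite fE //; near: y; exact: near_disk.
by apply: is_derive_eq; rewrite add0r.
Unshelve. all: by end_near. Qed.

Lemma derive1_disk_frac f P V (c : C) m :
  (forall x, `|x| < 1 -> V.[x] != 0) ->
  (forall x, `|x| < 1 -> f x = c + x ^+ m.+1 * P.[x] / V.[x]) ->
  exists P' V', (forall x, `|x| < 1 -> V'.[x] != 0) /\
    forall x, `|x| < 1 -> (f^`())%classic x = x ^+ m * P'.[x] / V'.[x].
Proof.
move=> V0 fE.
(* The quotient rule for [x ^+ m.+1 * P / V], with [x ^+ m] factored out. *)
exists (m.+1%:R *: P * V + 'X * (P^`() * V - P * V^`())), (V ^+ 2); split.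
  by move=> x x1; rewrite horner_exp expf_neq0 ?V0.
move=> x x1; rewrite derive1E.
have df := @is_derive_disk_frac f ('X^(m.+1) * P) V c V0 _ x x1.
have -> := @derive_val _ _ _ _ _ _ _ (df _).
  congr (_ / _); rewrite derivM derivXn /= -scaler_nat.
  rewrite !(hornerD, hornerN, hornerM, hornerZ, hornerXn, hornerX) exprS.
  by ring.
by move=> y y1; rewrite fE // hornerM hornerXn.
Qed.

(** The term [c *+ (j == 0%N)] lets one invariant cover [f] itself and its derivatives, where the
    constant has disappeared. *)
Lemma derive1n_disk_frac f P V (c : C) m j : (j <= m)%N ->
  (forall x, `|x| < 1 -> V.[x] != 0) ->
  (forall x, `|x| < 1 -> f x = c + x ^+ m * P.[x] / V.[x]) ->
  exists P' V', (forall x, `|x| < 1 -> V'.[x] != 0) /\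
    forall x, `|x| < 1 ->
      (f^`(j))%classic x = c *+ (j == 0%N) + x ^+ (m - j) * P'.[x] / V'.[x].
Proof.
move=> + V0 fE; elim: j => [_|j IHj lt_jm]; first by exists P, V; rewrite subn0.
have [P' [V' [V'0 fE']]] := IHj (ltnW lt_jm).
have [|P'' [V'' [V''0 fE'']]] :=
  @derive1_disk_frac (f^`(j))%classic P' V' (c *+ (j == 0%N)) (m - j.+1) V'0.
  by move=> x x1; rewrite fE' // -subSn.
by exists P'', V''; split=> // x x1; rewrite derive1nS fE'' //= add0r.
Qed.

Lemma derive1n_disk_frac0 f P V (c : C) m j : (0 < j < m)%N ->
  (forall x, `|x| < 1 -> V.[x] != 0) ->
  (forall x, `|x| < 1 -> f x = c + x ^+ m * P.[x] / V.[x]) ->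
  (f^`(j))%classic 0 = 0.
Proof.
move=> /andP[j0 jm] V0 fE.
have [P' [V' [_ ->]]] := derive1n_disk_frac (ltnW jm) V0 fE; last first.
  by rewrite normr0.
by rewrite gtn_eqF // expr0n subn_eq0 leqNgt jm /= !mul0r addr0.
Qed.
End Disk.

(** * The unit ball of bounded analytic functions and the final construction *)

Lemma Hinf_bound1 (R : realType) (f : R[i]^o -> R[i]^o) :
  (forall x : R[i]^o, `|x| < 1 -> derivable f x 1) ->
  (forall x : R[i]^o, `|x| < 1 -> `|f x| <= 1) -> Hinf f /\ supnorm f <= 1.
Proof.
move=> df f1; split; [split=> //|].
  rewrite /bounded_near; near=> M => x /f1 fx1; apply: (le_trans fx1); near: M.
  by apply: nbhs_pinfty_ge; rewrite real1.
apply: ge_sup.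
  by exists (complex.Re `|f 0|), 0 => //=; rewrite /disk /= normr0.
by move=> _ [x /f1 + <-]; rewrite lecE => /andP[_].
Unshelve. all: by end_near. Qed.

Theorem theorem4p2 (R : realType) (p : nat) (k : nat -> nat) (K : set nat)
    (n : nat) (z w : 'I_n -> R[i])
    (hp : (1 <= p)%N)
    (hk1 : (1 < k 1)%N)
    (hk : forall i : nat, (1 <= i < p)%N -> (k i < k i.+1)%N)
    (hK : K = [set m : nat |
                 m = 1%N \/ exists i : nat, (1 <= i <= p)%N /\ m = k i])
    (halg : is_algebra (@HinfK R K))
    (hz : forall i, disk (z i))
    (hz_inj : injective z)
    (hw : forall i, disk (w i)) :
  (exists lambda : R[i], disk lambda /\
     psdmx (\matrix_(i < n, j < n)
       ((z i ^+ (k p).+1 * (z j ^+ (k p).+1)^*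
         - blaschke lambda (w i) * (blaschke lambda (w j))^*)
        / (1 - z i * (z j)^*)))) ->
  exists f : R[i]^o -> R[i]^o,
    [/\ HinfK K f, forall i, f (z i) = w i & supnorm f <= 1].
Proof.
case=> l [l1 [_ psdA]].
have kP i : (1 <= i <= p)%N -> (1 < k i <= k p)%N.
  move=> /andP[i0 ip]; apply/andP; split.
    elim: i i0 ip => [//|[//|i] IHi] _ ip.
    by apply: (ltn_trans (IHi isT (ltnW ip))); apply: hk.
  move: ip; elim: p {hp hK psdA} hk => [|q IHq] hk; first by case: i i0.
  rewrite leq_eqVlt => /orP[/eqP -> //|iq].
  apply: (leq_trans (IHq _ iq)) => [j /andP[j0 jq]|].
    by apply: hk; rewrite j0 ltnW.
  by apply/ltnW/hk; rewrite ltnSn (leq_trans i0).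
set m := (k p).+1 in psdA.
have hKm j : K j -> (0 < j < m)%N.
  rewrite hK => -[->|[i [ip ->]]]; last first.
    by have /andP[k1 kp] := kP i ip; rewrite ltnS kp ltnW.
  have /andP[k1 kp] := kP 1%N hp.
  by rewrite /= ltnS; exact: ltnW (leq_trans k1 kp).
(* Extension to sequences over [nat]; the default 0 is only taken at indices outside the range of
   interpolation. *)
pose ext (u : 'I_n -> R[i]) i := oapp u 0 (insub i).
have extE u (i : 'I_n) : ext u i = u i by rewrite /ext valK.
pose b i := blaschke l (w i).
have [i lt_in||P [Q [PQ1 PQ]]] :=
    @pick_interpolation _ n (ext z) (ext (fun i => z i ^+ m)) (ext b).
- by rewrite (extE _ (Ordinal lt_in)); exact: hz.
- move=> c; have := psdA (\col_i c i); congr (_ <= _).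
  rewrite !mxE; under eq_bigr do rewrite !mxE mulr_suml.
  rewrite exchange_big; apply: eq_bigr => i _; apply: eq_bigr => j _.
  by rewrite !mxE /pick_kernel !extE mulrAC.
have PQ' i : b i * Q.[z i] = z i ^+ m * P.[z i].
  by have := PQ i (ltn_ord i); rewrite !extE.
(* [f] is [(l + g) / (1 + l^* g)] for [g = x ^+ m * P / Q], with denominators cleared. *)
pose V := Q + l^* *: ('X^m * P).
pose f (x : R[i]^o) : R[i]^o := (l *: Q + 'X^m * P).[x] / V.[x].
have Vf1 x : `|x| < 1 -> V.[x] != 0 /\ `|f x| <= 1.
  move=> x1; have [Q0 PQx] := PQ1 x x1.
  have le_PQ : `|x ^+ m * P.[x]| <= `|Q.[x]|.
    rewrite normrM normrX -[leRHS]mul1r ler_pM ?exprn_ge0 //.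
    by rewrite exprn_ile1 // ltW.
  have := @mobius_frac _ 1 l _ _ _ Q0 le_PQ; rewrite normr1 rmorph1 !mul1r.
  move=> /(_ l1); rewrite /f /V !(hornerD, hornerZ, hornerM, hornerXn).
  move=> [V0 fV]; split=> //.
  by rewrite normf_div ler_pdivrMr ?normr_gt0 // mul1r.
have V0 x (x1 : `|x| < 1) := (Vf1 x x1).1.
have f1 x (x1 : `|x| < 1) := (Vf1 x x1).2.
(* In [f - l] the terms [l *: Q] cancel, leaving a factor [x ^+ m]; its order exceeds every element
   of [K]. *)
have fE x : `|x| < 1 -> f x = l + x ^+ m * ((1 - l * l^*) *: P).[x] / V.[x].
  move=> /V0; rewrite /f /V !(hornerD, hornerZ, hornerM, hornerXn) => Vx.
  by field.
have df (x : R[i]^o) (x1 : `|x| < 1) : derivable f x 1.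
  have fE' y : `|y| < 1 -> f y = l + ('X^m * ((1 - l * l^*) *: P)).[y] / V.[y].
    by move=> /fE ->; rewrite hornerM hornerXn.
  by have [] := is_derive_disk_frac V0 fE' x1.
have [Hf normf] := Hinf_bound1 df f1.
exists f; split=> //.
  by split=> // j /hKm jm; exact: derive1n_disk_frac0 jm V0 fE.
move=> i; have Vz := V0 _ (hz i); apply: (canLR (mulfK Vz)).
(* At [z i] the condition [PQ'] makes the inner value [b i], and the outer automorphism inverts
   [blaschke l]. *)
have nz : 1 - l^* * w i != 0 by rewrite mulrC norm_disk_neq //; exact: hw.
rewrite /V !(hornerD, hornerZ, hornerM, hornerXn) -PQ' /b /blaschke.
by field.
Qed.
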